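(* Let $M>0$. There exist two sequences of probability measures $\{\pi_n\}$ and $\{\eta_n\}$ on $\mathbb R$ supported on $[-M,M]$ such that, writing $\mathrm{TV}_n:=\mathrm{TV}(f_{\pi_n},f_{\eta_n})$ and $H_n:=H(f_{\pi_n},f_{\eta_n})$, one has $\mathrm{TV}_n\downarrow 0$ as $n\to\infty$, and for all $n$ both $\mathrm{TV}_n<e^{-e}$ and $$H_n\ge \mathrm{TV}_n^{\,1-\alpha^*(\mathrm{TV}_n)},\qquad\text{where}\quad \alpha^*(t):=\frac{0.33}{\log\log(1/t)}.$$
   Context: For a probability measure $\pi$ on $\mathbb R$, $f_\pi(x):=\int_{\mathbb R}\phi(x-\theta)\,d\pi(\theta)$, where $\phi(x)=(2\pi)^{-1/2}e^{-x^2/2}$. For densities $p,q$ on $\mathbb R$: $\mathrm{TV}(p,q)=\frac12\int|p-q|$ and $H(p,q)=\sqrt{\frac12\int(\sqrt p-\sqrt q)^2}$. *)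

(* Defs.v *)
From HB Require Import structures.
From mathcomp Require Import all_boot all_order all_algebra.
From mathcomp Require Import all_classical all_reals all_analysis.

Set Implicit Arguments.
Unset Strict Implicit.
Unset Printing Implicit Defensive.

Import Order.TTheory GRing.Theory Num.Theory.
Import numFieldNormedType.Exports.

Local Open Scope classical_set_scope.
Local Open Scope ring_scope.

Definition phi (R : realType) (x : R) : R := normal_pdf 0 1 x.

Lemma phiE (R : realType) (x : R) :
  phi x = (Num.sqrt (2 * pi))^-1 * expR (- (x ^+ 2) / 2).
Proof.
rewrite /phi normal_pdfE ?oner_neq0 // /normal_peak /normal_fun.
by rewrite expr1n mul1r subr0 mulr_natl.
Qed.

(* The set [A] is meant to be closed; for such [A] this says that the
   topological support of [mu] is included in [A]. *)
Definition supported_on (R : realType)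
    (mu : probability (measurableTypeR R) R) (A : set R) : Prop :=
  mu (~` A) = 0%E.

Definition gauss_mixture (R : realType)
    (mu : probability (measurableTypeR R) R) (x : R) : R :=
  Rintegral mu setT (fun theta => phi (x - theta)).

(* [Rintegral] is total and returns a default value when the integral is
   infinite; for densities [p] and [q] the two integrals below are finite. *)
Definition TV (R : realType) (p q : R -> R) : R :=
  2^-1 * Rintegral (@lebesgue_measure R) setT (fun x => `|p x - q x|).

Definition hellinger (R : realType) (p q : R -> R) : R :=
  Num.sqrt (2^-1 * Rintegral (@lebesgue_measure R) setT
    (fun x => (Num.sqrt (p x) - Num.sqrt (q x)) ^+ 2)).

(* Since [ln] and division are total, this is meaningful only for
   [0 < t < 1] with [t != expR (-1)]. *)
Definition alpha_star (R : realType) (t : R) : R :=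
  (33 / 100) / ln (ln (1 / t)).

(* Main.v *)
(** For odd [k] and [h = M / k] take [pi] proportional to
    [\sum_(j even) 'C(k, j) * exp (t_j ^ 2 / 2) * dirac t_j] with equally spaced
    nodes [t_j = (2 j - k) h] in [[-M, M]], and let [eta] be its reflection. The
    factor [exp (t ^ 2 / 2)] cancels the one in
    [phi (x - t) = phi x * exp (x t) * exp (- t ^ 2 / 2)], so by the binomial theorem
    the two densities are [kappa * phi x * (cosh (h x) ^ k -+ sinh (h x) ^ k)] with
    [kappa] bounded above and below. Hence
      [TV = kappa * \int phi * |sinh (h x)| ^ k] and
      [H ^ 2 >= kappa / 2 * \int phi * sinh (h x) ^ (2 k) / cosh (h x) ^ k].
    Up to factors [exp (O (M |x|))], the first is [\int phi |h x| ^ k] and the second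
    [\int phi |h x| ^ (2 k)]. By Cauchy-Schwarz [TV ^ 2] is at most a constant times
    the integral of [|h x| ^ (2 k)] against a Gaussian of exponent close to
    [- x ^ 2], instead of [- x ^ 2 / 2], and rescaling gives
    [H / TV >= C * (5 / 4) ^ k].
    Since moreover [ln (1 / TV) <= k / 2 * ln k + O (k)], the quotient
    [ln (1 / TV) / ln (ln (1 / TV))] is at most [(1 / 2 + o (1)) k], and
    [0.33 / 2 < 1 / 5 <= ln (5 / 4)] concludes. *)
Require Import Defs.
From HB Require Import structures.
From mathcomp Require Import all_boot all_order all_algebra.
From mathcomp Require Import all_classical all_reals all_analysis.
From mathcomp Require Import measurable_realfun.
From mathcomp Require Import ring lra.

Import Order.TTheory GRing.Theory Num.Theory.
Import numFieldNormedType.Exports.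

Local Open Scope classical_set_scope.
Local Open Scope ring_scope.

Set Implicit Arguments.
Unset Strict Implicit.
Unset Printing Implicit Defensive.

(** * Finitely supported probability measures *)

Section discrete_probability.
Context (R : realType) (N : nat) (w : nat -> {nonneg R}) (t : nat -> R).

Definition discrete_measure : {measure set (measurableTypeR R) -> \bar R} :=
  msum (fun i => mscale (w i) (dirac (t i : measurableTypeR R))) N.

(** [mnormalize] gives a probability for arbitrary weights, with the Dirac mass at 0 as default when
    the total mass is 0 or infinite; for total weight 1 it changes nothing, by [discrete_probE]. *)
Definition discrete_prob : probability (measurableTypeR R) R :=
  mnormalize discrete_measure (dirac (0 : measurableTypeR R)).

Lemma discrete_measureE (A : set (measurableTypeR R)) :
  discrete_measure A = (\sum_(i < N) (w i)%:num%:E * \d_(t i) A)%E.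
Proof. by []. Qed.

Hypothesis w1 : \sum_(i < N) (w i)%:num = 1.

Lemma discrete_probE (A : set (measurableTypeR R)) :
  discrete_prob A = discrete_measure A.
Proof.
have d1 : discrete_measure [set: measurableTypeR R] = 1%E.
  rewrite discrete_measureE -[in RHS]w1 -sumEFin; apply: eq_bigr => i _.
  by rewrite diracT mule1.
by rewrite /discrete_prob/= /mnormalize d1 onee_eq0/= invr1 mule1.
Qed.

Lemma discrete_prob_supported (A : set R) :
  (forall i, (i < N)%N -> A (t i)) -> supported_on discrete_prob A.
Proof.
move=> At; rewrite /supported_on discrete_probE discrete_measureE big1// => i _.
by rewrite diracE memNset ?mule0// => /(_ (At i (ltn_ord i))).
Qed.

Lemma Rintegral_discrete_prob (f : R -> R) : measurable_fun setT f ->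
  (forall x, 0 <= f x) ->
  Rintegral discrete_prob setT f = \sum_(i < N) (w i)%:num * f (t i).
Proof.
move=> mf f0; rewrite /Rintegral.
rewrite (@eq_measure_integral _ _ _ _ discrete_measure); last first.
  by move=> A _ _; exact: discrete_probE.
have mEf : measurable_fun [set: measurableTypeR R] (fun x => (f x)%:E).
  exact/measurable_EFinP.
rewrite /discrete_measure ge0_integral_measure_sum//; last first.
  by move=> x _; rewrite lee_fin.
transitivity (fine (\sum_(i < N) ((w i)%:num * f (t i))%:E)%E); last first.
  by rewrite sumEFin.
congr fine; apply: eq_bigr => i _.
rewrite ge0_integral_mscale//; last by move=> x _; rewrite lee_fin.
by rewrite integral_dirac// diracT mul1e EFinM.
Qed.

End discrete_probability.

(** * Elementary bounds on hyperbolic functions *)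

Section hyperbolic.
Context (R : realType).
Implicit Types x u : R.

Definition cosh x := (expR x + expR (- x)) / 2.
Definition sinh x := (expR x - expR (- x)) / 2.

Lemma cosh0 : cosh 0 = 1. Proof. by rewrite /cosh oppr0 expR0; field. Qed.
Lemma sinh0 : sinh 0 = 0. Proof. by rewrite /sinh oppr0 subrr mul0r. Qed.
Lemma coshN u : cosh (- u) = cosh u.
Proof. by rewrite /cosh opprK addrC. Qed.
Lemma sinhN u : sinh (- u) = - sinh u.
Proof. by rewrite /sinh opprK -mulNr opprB. Qed.

Lemma cosh_gt0 u : 0 < cosh u.
Proof. by rewrite divr_gt0// addr_gt0 ?expR_gt0. Qed.

Lemma normr_sinhE u : `|sinh u| = sinh `|u|.
Proof.
have H v : 0 <= v -> `|sinh v| = sinh v.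
  move=> v0; rewrite ger0_norm// divr_ge0// subr_ge0 ler_expR; lra.
have [u0|/ltW u0] := leP 0 u; first by rewrite H// ger0_norm.
by rewrite (ler0_norm u0) -normrN -sinhN H// oppr_ge0.
Qed.

Lemma normr_sinh_le_cosh u : `|sinh u| <= cosh u.
Proof.
have := expR_gt0 u; have := expR_gt0 (- u); rewrite /sinh /cosh => ? ?.
by rewrite ler_norml; lra.
Qed.

Lemma cosh_le_expR u : cosh u <= expR `|u|.
Proof.
have h1 : expR u <= expR `|u| by rewrite ler_expR ler_norm.
have h2 : expR (- u) <= expR `|u| by rewrite ler_expR -normrN ler_norm.
rewrite /cosh; lra.
Qed.

(** Multiply [1 - 2 v <= exp (- 2 v)] by [exp v / 2], where [v = |u|]. *)
Lemma normr_sinh_le u : `|sinh u| <= `|u| * expR `|u|.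
Proof.
rewrite normr_sinhE; move: `|u| (normr_ge0 u) => v v0.
have h := expR_ge1Dx (- v - v).
rewrite expRD in h.
have e : expR v * expR (- v) = 1 by rewrite -expRD subrr expR0.
have := expR_gt0 v; have := expR_gt0 (- v); rewrite /sinh; nra.
Qed.

(** Multiply [1 + 2 v <= exp (2 v)] by [exp (- v) / 2], where [v = |u|]. *)
Lemma normr_sinh_ge u : `|u| * expR (- `|u|) <= `|sinh u|.
Proof.
rewrite normr_sinhE; move: `|u| (normr_ge0 u) => v v0.
have h := expR_ge1Dx (v + v).
rewrite expRD in h.
have e : expR v * expR (- v) = 1 by rewrite -expRD subrr expR0.
have := expR_gt0 v; have := expR_gt0 (- v); rewrite /sinh; nra.
Qed.

(** Follows from [v <= exp (v - 1)]. The factor [exp (- 1)] becomes [exp (- k)] in the [k]-th power,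
    which makes the total variation tend to 0. *)
Lemma normr_sinh_leB1 u : `|sinh u| <= expR (2 * `|u| - 1).
Proof.
apply: (le_trans (normr_sinh_le u)).
have h := expR_ge1Dx (`|u| - 1).
have -> : 2 * `|u| - 1 = (`|u| - 1) + `|u| by ring.
by rewrite expRD ler_wpM2r ?expR_ge0//; lra.
Qed.

Lemma continuous_cosh : continuous cosh.
Proof.
move=> x; apply: cvgMl; apply: cvgD; first exact: continuous_expR.
by apply: continuous_comp; [exact: cvgN|exact: continuous_expR].
Qed.

Lemma continuous_sinh : continuous sinh.
Proof.
move=> x; apply: cvgMl; apply: cvgB; first exact: continuous_expR.
by apply: continuous_comp; [exact: cvgN|exact: continuous_expR].
Qed.

End hyperbolic.

(** * The two mixtures with binomial weights and their densities *)

Lemma sum_even_binomial (R : realFieldType) (k : nat) (a b : R) :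
  \sum_(j < k.+1) (~~ odd j)%:R * ('C(k, j)%:R * (a ^+ (k - j) * b ^+ j)) =
  ((a + b) ^+ k + (a - b) ^+ k) / 2.
Proof.
rewrite exprDn exprBn -big_split mulr_suml; apply: eq_bigr => j _ /=.
rewrite -mulrA -[X in _ + X]mulrnAr -signr_odd -(mulr_natl (_ * _) 'C(k, j)).
move: ('C(k, j)%:R * _) => c; case: (odd j) => /=.
  by rewrite expr1 mul0r mulN1r subrr mul0r.
by rewrite expr0; field.
Qed.

Section mixtures.
Context (R : realType).
Implicit Types (M x t : R) (k : nat).

Lemma phi_gt0 x : 0 < phi x.
Proof.
by rewrite phiE mulr_gt0 ?expR_gt0// invr_gt0 sqrtr_gt0 mulr_gt0 ?pi_gt0.
Qed.

Lemma phiN x : phi (- x) = phi x.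
Proof. by rewrite !phiE sqrrN. Qed.

Lemma phi_shift x t : phi (x - t) = phi x * expR (x * t) * expR (- (t ^+ 2 / 2)).
Proof. by rewrite !phiE -2!mulrA -2!expRD; congr (_ * expR _); field. Qed.

Definition node M k (j : nat) : R := (2 * j%:R - k%:R) * (M / k%:R).

Lemma node_itv M k j : 0 <= M -> (0 < k)%N -> (j < k.+1)%N ->
  - M <= node M k j <= M.
Proof.
move=> M0 k0; rewrite ltnS -(ler_nat R) => jk.
have kR : 0 < k%:R :> R by rewrite ltr0n.
have j0 : 0 <= j%:R :> R by [].
have e : M = k%:R * (M / k%:R) by field; rewrite gt_eqF.
have h : 0 <= M / k%:R by rewrite divr_ge0// ltW.
rewrite [X in - X <= _ <= X]e /node; move: (M / _) h => h h0.
by apply/andP; split; nra.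
Qed.

Lemma expR_node M k j x : (j < k.+1)%N ->
  expR (x * node M k j) =
  expR (- (x * (M / k%:R))) ^+ (k - j) * expR (x * (M / k%:R)) ^+ j.
Proof.
rewrite ltnS => jk; rewrite -!expRM_natl -expRD natrB// /node.
by congr expR; ring.
Qed.

Let bin_even k j : R := (~~ odd j)%:R * 'C(k, j)%:R.

(** Since [2 j - k = j - (k - j)], these are the even terms of a binomial expansion in [exp (- u)]
    and [exp u], whose sum is [2 cosh u] and whose difference is [- 2 sinh u]; for odd [k] the sign
    comes out of the power. *)
Lemma sum_expR_node M k x : odd k ->
  \sum_(j < k.+1) bin_even k j * expR (x * node M k j) =
  2 ^+ k * (cosh (x * (M / k%:R)) ^+ k - sinh (x * (M / k%:R)) ^+ k) / 2.
Proof.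
move=> ok; set u := x * (M / k%:R).
under eq_bigr => j _ do rewrite expR_node// -mulrA -/u.
rewrite sum_even_binomial mulrBr -!exprMn; congr (_ / _).
have -> : 2 * cosh u = expR (- u) + expR u by rewrite /cosh; field.
have -> : expR (- u) - expR u = - (2 * sinh u) by rewrite /sinh; field.
by rewrite exprNn -signr_odd ok expr1 mulN1r.
Qed.

Lemma sum_bin_even k : odd k -> \sum_(j < k.+1) bin_even k j = 2 ^+ k / 2.
Proof.
move=> ok; have := @sum_expR_node 0 k 0 ok.
rewrite mul0r cosh0 sinh0 expr1n expr0n.
have -> : (k == 0)%N = false by case: k ok.
rewrite subr0 mulr1 => <-; apply: eq_bigr => j _.
by rewrite mul0r expR0 mulr1.
Qed.

Definition mass M k : R :=
  \sum_(j < k.+1) bin_even k j * expR (node M k j ^+ 2 / 2).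

(** Every node lies in [[- M, M]], so each factor [exp (t_j ^ 2 / 2)] is between 1 and
    [exp (M ^ 2 / 2)]. This is why [kappa] is bounded on both sides independently of [k]. *)
Lemma mass_bounds M k : 0 <= M -> odd k ->
  2 ^+ k / 2 <= mass M k <= 2 ^+ k / 2 * expR (M ^+ 2 / 2).
Proof.
move=> M0 ok; have k0 : (0 < k)%N by case: k ok.
have b0 j : 0 <= bin_even k j by rewrite mulr_ge0.
rewrite -(sum_bin_even ok) mulr_suml; apply/andP; split; apply: ler_sum => j _.
  rewrite ler_peMr// -[X in X <= _]expR0 ler_expR.
  by rewrite divr_ge0// sqr_ge0.
rewrite ler_wpM2l// ler_expR ler_pM2r ?invr_gt0//.
by rewrite -real_normK ?num_real// ler_sqr ?nnegrE// ler_norml node_itv.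
Qed.

Lemma mass_gt0 M k : 0 <= M -> odd k -> 0 < mass M k.
Proof.
move=> M0 ok; have /andP[+ _] := mass_bounds M0 ok.
by apply: lt_le_trans; rewrite divr_gt0// exprn_gt0.
Qed.

Fact weight_ge0 M k j : 0 <= bin_even k j * expR (node M k j ^+ 2 / 2) / mass M k.
Proof.
rewrite !mulr_ge0 ?expR_ge0// invr_ge0 sumr_ge0// => i _.
by rewrite !mulr_ge0 ?expR_ge0.
Qed.

Definition weight M k j : {nonneg R} := NngNum (weight_ge0 M k j).

Lemma sum_weight M k : 0 <= M -> odd k -> \sum_(j < k.+1) (weight M k j)%:num = 1.
Proof.
by move=> M0 ok; rewrite /= -mulr_suml divff// gt_eqF// mass_gt0.
Qed.

Definition kappa M k : R := 2 ^+ k / 2 / mass M k.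

Lemma kappa_bounds M k : 0 <= M -> odd k ->
  expR (- (M ^+ 2 / 2)) <= kappa M k <= 1.
Proof.
move=> M0 ok; have /andP[lo hi] := mass_bounds M0 ok.
have Z0 := mass_gt0 M0 ok.
by rewrite /kappa ler_pdivrMr// mul1r lo andbT ler_pdivlMr// expRN mulrC ler_pdivrMr// expR_gt0.
Qed.

Lemma measurable_phi_shift x : measurable_fun setT (fun t => phi (x - t)).
Proof.
by apply: measurableT_comp; [exact: measurable_normal_pdf|exact: measurable_funB].
Qed.

Definition even_mixture M k := discrete_prob k.+1 (weight M k) (node M k).

(** The reflected node [- t_j] equals [t_(k - j)], and [k - j] is odd when [k] is odd and [j] even:
    the mass moves to the nodes of odd index. *)
Definition odd_mixture M k :=
  discrete_prob k.+1 (weight M k) (fun j => - node M k j).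

Lemma even_mixture_supported M k : 0 <= M -> odd k ->
  supported_on (even_mixture M k) `[- M, M].
Proof.
move=> M0 ok; apply: discrete_prob_supported; first exact: sum_weight.
by move=> j jk; rewrite /= in_itv/= node_itv//; case: k ok {jk}.
Qed.

Lemma odd_mixture_supported M k : 0 <= M -> odd k ->
  supported_on (odd_mixture M k) `[- M, M].
Proof.
move=> M0 ok; apply: discrete_prob_supported; first exact: sum_weight.
move=> j jk; rewrite /= in_itv/= lerN2 lerNl andbC node_itv//.
by case: k ok {jk}.
Qed.

Lemma even_mixtureE M k x : 0 <= M -> odd k ->
  gauss_mixture (even_mixture M k) x = kappa M k * phi x *
  (cosh (x * (M / k%:R)) ^+ k - sinh (x * (M / k%:R)) ^+ k).
Proof.
move=> M0 ok; rewrite /gauss_mixture Rintegral_discrete_prob; last 3 first.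
- exact: sum_weight.
- exact: measurable_phi_shift.
- by move=> t; exact/ltW/phi_gt0.
transitivity (phi x / mass M k *
    \sum_(j < k.+1) bin_even k j * expR (x * node M k j)).
  rewrite mulr_sumr; apply: eq_bigr => j _ /=.
  rewrite phi_shift expRN; field.
  by rewrite !gt_eqF ?expR_gt0 ?mass_gt0.
rewrite sum_expR_node// /kappa; field.
by rewrite gt_eqF ?mass_gt0.
Qed.

Lemma odd_mixtureE M k x : 0 <= M -> odd k ->
  gauss_mixture (odd_mixture M k) x = kappa M k * phi x *
  (cosh (x * (M / k%:R)) ^+ k + sinh (x * (M / k%:R)) ^+ k).
Proof.
(* The weights agree and [phi] is even, so reflecting the nodes reflects the density. *)
move=> M0 ok; transitivity (gauss_mixture (even_mixture M k) (- x)).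
  rewrite /gauss_mixture !Rintegral_discrete_prob; try exact: sum_weight;
    try exact: measurable_phi_shift; try by move=> t; exact/ltW/phi_gt0.
  by apply: eq_bigr => j _; rewrite -[in RHS]phiN opprB !opprK addrC.
rewrite even_mixtureE// phiN mulNr coshN sinhN exprNn -signr_odd ok.
by rewrite expr1 mulN1r opprK.
Qed.

End mixtures.

(** * Integrals of powers against Gaussians *)

Section integrals.
Context {R : realType}.
Let mu := @lebesgue_measure R.
Implicit Types (a b x : R) (f g : R -> R).

Lemma dominated_integrable f g : measurable_fun setT f ->
  (forall x, `|f x| <= g x) -> mu.-integrable setT (EFin \o g) ->
  mu.-integrable setT (EFin \o f).
Proof.
move=> mf fg; apply: le_integrable => //; first exact/measurable_EFinP.
by move=> x _; rewrite lee_fin (le_trans (fg x))// ler_norm.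
Qed.

Lemma continuous_gauss_abs a b : continuous (fun x => expR (- (a * x ^+ 2) + b * `|x|)).
Proof.
move=> x; apply: (@continuous_comp _ _ _
  (fun x => - (a * x ^+ 2) + b * `|x|) expR); last exact: continuous_expR.
apply: cvgD; last by apply: cvgMr; apply: cvg_norm; exact: cvg_id.
by apply: cvgN; apply: cvgMr; exact: exprn_continuous.
Qed.

(** The integrand is a multiple of the normal density of variance [1 / (2 a)]. *)
Lemma integrable_gauss a : 0 < a ->
  mu.-integrable setT (EFin \o (fun x => expR (- (a * x ^+ 2)))).
Proof.
move=> a0; pose s := Num.sqrt (2 * a)^-1.
have s0 : 0 < s by rewrite sqrtr_gt0 invr_gt0 mulr_gt0.
have s2 : s ^+ 2 = (2 * a)^-1 by rewrite sqr_sqrtr// invr_ge0 mulr_ge0// ltW.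
have p0 : 0 < normal_peak s.
  by apply: normal_peak_gt0; rewrite gt_eqF.
have -> : EFin \o (fun x => expR (- (a * x ^+ 2))) =
    fun x => ((normal_peak s)^-1%:E * (normal_pdf 0 s x)%:E)%E.
  apply/funext => x /=; rewrite -EFinM normal_pdfE ?gt_eqF//.
  rewrite /=.
  rewrite mulKf ?gt_eqF// /normal_fun s2 subr0 -mulr_natl; congr (expR _)%:E.
  by field; rewrite gt_eqF.
by apply: integrableZl => //; exact: integrable_normal_pdf.
Qed.

Lemma integrable_gauss_abs a b : 0 < a ->
  mu.-integrable setT (EFin \o (fun x => expR (- (a * x ^+ 2) + b * `|x|))).
Proof.
move=> a0; apply: (@dominated_integrable _
    (fun x => expR (b ^+ 2 / (2 * a)) * expR (- (a / 2 * x ^+ 2)))).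
- by apply: continuous_measurable_fun; exact: continuous_gauss_abs.
- move=> x; rewrite ger0_norm ?expR_ge0// -expRD ler_expR -[x ^+ 2]real_normK ?num_real//.
  move: `|x| => y; rewrite -subr_ge0.
  (* Half of the quadratic exponent absorbs the linear term; what remains is a complete square. *)
  have -> : b ^+ 2 / (2 * a) + - (a / 2 * y ^+ 2) - (- (a * y ^+ 2) + b * y) =
    (a * y - b) ^+ 2 / (2 * a) by field; rewrite gt_eqF.
  by rewrite divr_ge0 ?sqr_ge0// mulr_ge0// ltW.
- have -> : EFin \o (fun x => expR (b ^+ 2 / (2 * a)) * expR (- (a / 2 * x ^+ 2))) =
      fun x => ((expR (b ^+ 2 / (2 * a)))%:E * (expR (- (a / 2 * x ^+ 2)))%:E)%E.
    by apply/funext => x /=; rewrite EFinM.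
  by apply: integrableZl => //; apply: integrable_gauss; rewrite divr_gt0.
Qed.

Lemma exprn_le_fact_expR n x : 0 <= x -> x ^+ n <= n`!%:R * expR x.
Proof.
move=> x0; rewrite mulrC -ler_pdivrMr ?ltr0n ?fact_gt0//.
case: n => [|n]; first by rewrite fact0 divr1 expr0 -[leLHS]expR0 ler_expR.
by have := expR_ge1Dxn n x0; apply: le_trans; rewrite lerDr.
Qed.

Lemma continuous_moment n a b :
  continuous (fun x => `|x| ^+ n * expR (- (a * x ^+ 2) + b * `|x|)).
Proof.
move=> x; apply: cvgM; last exact: continuous_gauss_abs.
apply: (@continuous_comp _ _ _ (fun x : R => `|x|) (fun x => x ^+ n)).
  by apply: cvg_norm; exact: cvg_id.
exact: exprn_continuous.
Qed.

(** By [exprn_le_fact_expR] the power costs only a constant and an increase of the linear exponent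
    from [b] to [b + 1]. *)
Lemma integrable_moment n a b : 0 < a -> mu.-integrable setT
  (EFin \o (fun x => `|x| ^+ n * expR (- (a * x ^+ 2) + b * `|x|))).
Proof.
move=> a0; apply: (@dominated_integrable _
    (fun x => n`!%:R * expR (- (a * x ^+ 2) + (b + 1) * `|x|))).
- by apply: continuous_measurable_fun; exact: continuous_moment.
- move=> x; rewrite ger0_norm ?mulr_ge0 ?expR_ge0 ?exprn_ge0//.
  rewrite mulrDl mul1r addrA [X in _ <= _ * X]expRD [leLHS]mulrC [leRHS]mulrCA.
  by rewrite ler_wpM2l ?expR_ge0// exprn_le_fact_expR.
- have -> : EFin \o (fun x => n`!%:R * expR (- (a * x ^+ 2) + (b + 1) * `|x|)) =
      fun x => ((n`!%:R)%:E * (expR (- (a * x ^+ 2) + (b + 1) * `|x|))%:E)%E.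
    by apply/funext => x /=; rewrite EFinM.
  by apply: integrableZl => //; exact: integrable_gauss_abs.
Qed.

Lemma integrable_scale c f : mu.-integrable setT (EFin \o f) ->
  mu.-integrable setT (EFin \o (fun x => c * f x)).
Proof.
move=> fi; have -> : EFin \o (fun x => c * f x) = fun x => (c%:E * (f x)%:E)%E.
  by apply/funext => x /=; rewrite EFinM.
exact: integrableZl.
Qed.

(** The polynomial [F t ^ 2 + 2 P t + G] is the integral of [(t f + g) ^ 2], hence nonnegative; for
    [F > 0] its value at the minimum [t = - P / F] gives the claim. *)
Lemma Rintegral_cauchy_schwarz f g :
  mu.-integrable setT (EFin \o (fun x => f x ^+ 2)) ->
  mu.-integrable setT (EFin \o (fun x => g x ^+ 2)) ->
  mu.-integrable setT (EFin \o (fun x => f x * g x)) ->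
  Rintegral mu setT (fun x => f x * g x) ^+ 2 <=
  Rintegral mu setT (fun x => f x ^+ 2) * Rintegral mu setT (fun x => g x ^+ 2).
Proof.
move=> f2 g2 fg.
set F := Rintegral mu setT (fun x => f x ^+ 2).
set G := Rintegral mu setT (fun x => g x ^+ 2).
set P := Rintegral mu setT _.
have quad t : 0 <= F * t ^+ 2 + 2 * P * t + G.
  have -> : F * t ^+ 2 + 2 * P * t + G =
      Rintegral mu setT (fun x => (t ^+ 2 * f x ^+ 2 + 2 * t * (f x * g x)) + g x ^+ 2).
    rewrite RintegralD//; last first.
      by apply: (@integrableD _ _ _ mu setT measurableT
        (EFin \o (fun x => t ^+ 2 * f x ^+ 2))
        (EFin \o (fun x => 2 * t * (f x * g x)))); exact: integrable_scale.
    rewrite RintegralD//; try exact: integrable_scale.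
    by rewrite !RintegralZl// -/F -/G -/P; ring.
  apply: Rintegral_ge0 => x _.
  have -> : t ^+ 2 * f x ^+ 2 + 2 * t * (f x * g x) + g x ^+ 2 = (t * f x + g x) ^+ 2 by ring.
  exact: sqr_ge0.
have F0 : 0 <= F by apply: Rintegral_ge0 => x _; exact: sqr_ge0.
have G0 : 0 <= G by apply: Rintegral_ge0 => x _; exact: sqr_ge0.
have [F1|] := ltP 0 F.
  have := quad (- P / F); rewrite -(ler_pM2l F1) mulr0.
  have -> : F * (F * (- P / F) ^+ 2 + 2 * P * (- P / F) + G) = F * G - P ^+ 2.
    by field; rewrite gt_eqF.
  by rewrite subr_ge0.
(* For [F = 0] the polynomial is affine in [t], and a nonzero slope would let it take the value
   -1. *)
move=> F1; have F2 : F = 0 by apply/eqP; rewrite eq_le F1 F0.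
rewrite F2 mul0r; have [->|P0] := eqVneq P 0; first by rewrite expr0n.
have := quad (- (G + 1) / (2 * P)); rewrite F2 mul0r add0r.
have -> : 2 * P * (- (G + 1) / (2 * P)) + G = -1 by field.
by rewrite ler0N1.
Qed.

(* The substitution [x = 5/4 y] turns the exponent 3/5 into 15/16. *)
Lemma moment_scale n : Rintegral mu setT (fun x => `|x| ^+ n * expR (- (3 / 5 * x ^+ 2))) =
  (5 / 4) ^+ n.+1 * Rintegral mu setT (fun x => `|x| ^+ n * expR (- (15 / 16 * x ^+ 2))).
Proof.
pose F (x : R) := 5 / 4 * x.
have dF x : is_derive x 1 F (5 / 4).
  by apply: is_derive_eq; rewrite /GRing.scale/= mulr1.
have F'E : derive1 F = cst (5 / 4) by apply/funext => x; rewrite derive1E derive_val.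
have cm (c : R) : continuous (fun x => `|x| ^+ n * expR (- (c * x ^+ 2))).
  rewrite (_ : (fun x => _) = (fun x => `|x| ^+ n * expR (- (c * x ^+ 2) + 0 * `|x|))).
    exact: continuous_moment.
  by apply/funext => x; rewrite mul0r addr0.
have key x : `|5 / 4 * x| ^+ n * expR (- (3 / 5 * (5 / 4 * x) ^+ 2)) * (5 / 4) =
    (5 / 4) ^+ n.+1 * (`|x| ^+ n * expR (- (15 / 16 * x ^+ 2))).
  rewrite normrM ger0_norm// exprMn [in RHS]exprS.
  have -> : 3 / 5 * (5 / 4 * x) ^+ 2 = 15 / 16 * x ^+ 2 by field.
  ring.
rewrite /Rintegral (@increasing_ge0_integration_by_substitutionT _ F); last first.
- by move=> x; rewrite mulr_ge0 ?expR_ge0 ?exprn_ge0.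
- exact: cm.
- by apply: gt0_cvgMry.
- by apply: gt0_cvgMrNy.
- by move=> x; exact: ex_derive.
- by rewrite F'E; exact: is_cvg_cst.
- by rewrite F'E; exact: is_cvg_cst.
- by rewrite F'E => x; exact: cvg_cst.
- by move=> x y xy; rewrite /F ltr_pM2l.
rewrite -[RHS]RintegralZl//; last first.
  have := @integrable_moment n (15 / 16) 0 ltac:(lra).
  by under eq_fun do rewrite mul0r addr0.
congr fine; apply: eq_integral => x _ /=; congr EFin.
by rewrite F'E; exact: key.
Qed.

End integrals.

(** * Total variation and Hellinger distance of the two mixtures *)

Lemma sqr_sub_sqrt_bounds (R : rcfType) (w C S : R) : 0 <= w -> `|S| <= C ->
  w * (S ^+ 2 / C) <= (Num.sqrt (w * (C - S)) - Num.sqrt (w * (C + S))) ^+ 2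
                   <= 2 * (w * `|S|).
Proof.
move=> w0; rewrite ler_norml => /andP[SC1 SC2].
have C0 : 0 <= C by lra.
have p0 : 0 <= w * (C - S) by rewrite mulr_ge0//; lra.
have q0 : 0 <= w * (C + S) by rewrite mulr_ge0//; lra.
have a2 := sqr_sqrtr p0; have b2 := sqr_sqrtr q0.
have := sqrtr_ge0 (w * (C - S)); have := sqrtr_ge0 (w * (C + S)).
move: (Num.sqrt _) a2 => a a2; move: (Num.sqrt _) b2 => b b2 b0 a0.
apply/andP; split; last first.
  (* Upper bound: [|a - b| <= a + b] for nonnegative roots. It later yields integrability of the
     Hellinger integrand. *)
  have h : (a - b) ^+ 2 <= `|a ^+ 2 - b ^+ 2|.
    rewrite subr_sqr normrM -[leLHS]real_normK ?num_real// expr2 ler_wpM2l//.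
    by rewrite [leRHS]ger0_norm ?addr_ge0// ler_norml; lra.
  apply: (le_trans h); rewrite a2 b2 -mulrBr.
  have -> : C - S - (C + S) = - (2 * S) by ring.
  by rewrite mulrN normrN !normrM (ger0_norm w0) ger0_norm// mulrCA.
(* In both degenerate cases the left side is 0; for [C = 0] by the convention that 0 has inverse
   0. *)
have [->|wn0] := eqVneq w 0; first by rewrite mul0r sqr_ge0.
have [->|Cn0] := eqVneq C 0; first by rewrite invr0 !mulr0 sqr_ge0.
have w1 : 0 < w by rewrite lt_neqAle eq_sym wn0.
have C1 : 0 < C by rewrite lt_neqAle eq_sym Cn0.
(* Lower bound: divide [(a ^ 2 - b ^ 2) ^ 2] by [(a + b) ^ 2], which is at most
   [2 (a ^ 2 + b ^ 2) = 4 w C]. *)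
have h : (a - b) ^+ 2 * (a + b) ^+ 2 = 4 * w ^+ 2 * S ^+ 2.
  by rewrite -exprMn -subr_sqr a2 b2; ring.
have h2 : (a + b) ^+ 2 <= 4 * (w * C).
  have := sqr_ge0 (a - b); rewrite sqrrB sqrrD a2 b2; lra.
have h3 : 4 * w ^+ 2 * S ^+ 2 <= (a - b) ^+ 2 * (4 * (w * C)).
  by rewrite -h ler_wpM2l// sqr_ge0.
rewrite mulrA ler_pdivrMr// -(ler_pM2l (_ : 0 < 4 * w)) ?mulr_gt0//.
have -> : 4 * w * (w * S ^+ 2) = 4 * w ^+ 2 * S ^+ 2 by ring.
by apply: (le_trans h3); rewrite le_eqVlt; apply/orP; left; apply/eqP; ring.
Qed.

Section distances.
Context {R : realType}.
Let mu := @lebesgue_measure R.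
Variables (M : R) (k : nat).
Hypotheses (M0 : 0 < M) (ok : odd k).
Implicit Types x : R.

Let k0 : 0 < k%:R :> R. Proof. by rewrite ltr0n; case: k ok. Qed.

Definition phi_peak : R := (Num.sqrt (2 * pi))^-1.

Lemma phi_peak_gt0 : 0 < phi_peak.
Proof. by rewrite invr_gt0 sqrtr_gt0 mulr_gt0 ?pi_gt0. Qed.

Lemma phi_expR x : phi x = phi_peak * expR (- (1 / 2 * x ^+ 2)).
Proof. by rewrite phiE; congr (_ * expR _); field. Qed.

Definition tv_density x := phi x * `|sinh (x * (M / k%:R))| ^+ k.

(** For the mixture densities [p] and [q], [(p - q) ^ 2 / (p + q)] is [2 * kappa M k] times this:
    the integrand of a symmetrised chi-square divergence, a lower bound for the Hellinger integrand
    up to a constant. *)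
Definition chi_density x :=
  phi x * ((sinh (x * (M / k%:R)) ^+ k) ^+ 2 / cosh (x * (M / k%:R)) ^+ k).

Lemma normr_scaled x : `|x * (M / k%:R)| = `|x| * (M / k%:R).
Proof. by rewrite normrM (@ger0_norm _ (M / _))// divr_ge0// ltW. Qed.

(** The spacing [M / k] is chosen for this: an error factor exponential in the argument of [sinh] or
    [cosh] has a [k]-th power that no longer depends on [k]. *)
Lemma expR_scaled (c : R) x : expR (c * (`|x| * (M / k%:R))) ^+ k = expR (c * M * `|x|).
Proof. by rewrite -expRM_natl; congr expR; field; rewrite gt_eqF. Qed.

Lemma tv_density_ge0 x : 0 <= tv_density x.
Proof. by rewrite mulr_ge0 ?exprn_ge0// ltW ?phi_gt0. Qed.

Lemma tv_density_le x : tv_density x <= phi_peak * (M / k%:R) ^+ k *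
  (`|x| ^+ k * expR (- (1 / 2 * x ^+ 2) + M * `|x|)).
Proof.
have eM := expR_scaled 1 x; rewrite !mul1r in eM.
rewrite /tv_density phi_expR expRD -eM.
have : `|sinh (x * (M / k%:R))| ^+ k <=
    (`|x| * (M / k%:R)) ^+ k * expR (`|x| * (M / k%:R)) ^+ k.
  rewrite -exprMn -normr_scaled lerXn2r ?nnegrE ?mulr_ge0 ?expR_ge0//.
  exact: normr_sinh_le.
rewrite exprMn => {}h.
have p := phi_peak_gt0; have e := expR_gt0 (- (1 / 2 * x ^+ 2)).
rewrite -(ler_pM2l (mulr_gt0 p e)) in h.
by apply: (le_trans h); rewrite le_eqVlt; apply/orP; left; apply/eqP; ring.
Qed.

Lemma tv_density_ge x : phi_peak * (M / k%:R) ^+ k *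
  (`|x| ^+ k * expR (- (1 / 2 * x ^+ 2) + (- M) * `|x|)) <= tv_density x.
Proof.
have eM := expR_scaled (- 1) x; rewrite !mulN1r in eM.
rewrite /tv_density phi_expR expRD -eM.
have : (`|x| * (M / k%:R)) ^+ k * expR (- (`|x| * (M / k%:R))) ^+ k <=
    `|sinh (x * (M / k%:R))| ^+ k.
  rewrite -exprMn -normr_scaled lerXn2r ?nnegrE ?mulr_ge0 ?expR_ge0//.
  exact: normr_sinh_ge.
rewrite exprMn => h.
have p := phi_peak_gt0; have e := expR_gt0 (- (1 / 2 * x ^+ 2)).
rewrite -(ler_pM2l (mulr_gt0 p e)) in h.
by apply: le_trans h; rewrite le_eqVlt; apply/orP; left; apply/eqP; ring.
Qed.

(** A cruder bound than [tv_density_le]: the power of [|x|] is given up for an explicit decay in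
    [k]. *)
Lemma tv_density_le_expRN x : tv_density x <= expR (- k%:R) *
  (phi_peak * expR (- (1 / 2 * x ^+ 2) + 2 * M * `|x|)).
Proof.
rewrite /tv_density phi_expR expRD -expR_scaled.
have : `|sinh (x * (M / k%:R))| ^+ k <=
    expR (2 * (`|x| * (M / k%:R))) ^+ k * expR (- k%:R).
  have -> : expR (- k%:R) = expR (- 1) ^+ k :> R by rewrite -expRM_natl mulrN1.
  rewrite -exprMn -expRD -normr_scaled.
  by rewrite lerXn2r ?nnegrE ?expR_ge0// normr_sinh_leB1.
move=> h.
have p := phi_peak_gt0; have e := expR_gt0 (- (1 / 2 * x ^+ 2)).
rewrite -(ler_pM2l (mulr_gt0 p e)) in h.
by apply: (le_trans h); rewrite le_eqVlt; apply/orP; left; apply/eqP; ring.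
Qed.

Lemma chi_density_ge x : phi_peak * ((M / k%:R) ^+ k) ^+ 2 *
  (`|x| ^+ (2 * k) * expR (- (1 / 2 * x ^+ 2) + - 3 * M * `|x|)) <= chi_density x.
Proof.
rewrite /chi_density phi_expR expRD -expR_scaled.
set y := `|x| * (M / k%:R).
have y0 : 0 <= y by rewrite /y mulr_ge0// divr_ge0// ltW.
have C0 := cosh_gt0 (x * (M / k%:R)).
(* Each of the [k] factors loses [exp (- 2 y)] in bounding [sinh ^ 2] from below and [exp (- y)] in
   bounding [cosh] from above. *)
have : (y ^+ k) ^+ 2 * expR (- 3 * y) ^+ k <=
    (sinh (x * (M / k%:R)) ^+ k) ^+ 2 / cosh (x * (M / k%:R)) ^+ k.
  have h1 := cosh_le_expR (x * (M / k%:R)); have h2 := normr_sinh_ge (x * (M / k%:R)).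
  rewrite normr_scaled -/y in h1 h2.
  move: (sinh _) (cosh _) y y0 C0 h1 h2 => s c y y0 C0 h1 h2.
  rewrite ler_pdivlMr ?exprn_gt0// exprAC [X in _ <= X]exprAC -!exprMn.
  apply: lerXn2r; rewrite ?nnegrE ?sqr_ge0//.
    by apply: mulr_ge0 (ltW C0); apply: mulr_ge0; rewrite ?expR_ge0 ?sqr_ge0.
  rewrite -[leRHS]real_normK ?num_real//.
  apply: (@le_trans _ _ ((y * expR (- y)) ^+ 2)); last first.
    by rewrite lerXn2r ?nnegrE ?mulr_ge0 ?expR_ge0.
  have -> : - 3 * y = - y + - y + - y by ring.
  rewrite !expRD.
  have -> : y ^+ 2 * (expR (- y) * expR (- y) * expR (- y)) * c =
     (y * expR (- y)) ^+ 2 * (expR (- y) * c) by ring.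
  by rewrite ler_piMr ?sqr_ge0// expRN mulrC ler_pdivrMr ?expR_gt0// mul1r.
move=> h.
have p := phi_peak_gt0; have e := expR_gt0 (- (1 / 2 * x ^+ 2)).
rewrite -(ler_pM2l (mulr_gt0 p e)) in h.
apply: le_trans h; rewrite /y mulnC exprM !exprMn le_eqVlt; apply/orP; left; apply/eqP.
ring.
Qed.

Lemma measurable_scaled (h : R -> R) : continuous h ->
  measurable_fun setT (fun x => h (x * (M / k%:R))).
Proof.
move=> ch; apply: measurableT_comp; first exact: continuous_measurable_fun.
exact: measurable_funM.
Qed.

Lemma measurable_phi : measurable_fun setT (@phi R).
Proof. exact: measurable_normal_pdf. Qed.

Lemma measurable_tv_density : measurable_fun setT tv_density.
Proof.
apply: measurable_funM; first exact: measurable_phi.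
apply: measurable_funX; apply: measurableT_comp => //.
by apply: measurable_scaled; exact: continuous_sinh.
Qed.

Lemma measurable_chi_density : measurable_fun setT chi_density.
Proof.
apply: measurable_funM; first exact: measurable_phi.
apply: measurable_funM.
  do 2 apply: measurable_funX.
  by apply: measurable_scaled; exact: continuous_sinh.
apply: (measurable_scaled (h := fun y => (cosh y ^+ k)^-1)) => y.
apply: cvgV; first by rewrite expf_eq0 gt_eqF ?cosh_gt0// andbF.
apply: (@continuous_comp _ _ _ (@cosh R) (fun z => z ^+ k)).
  exact: continuous_cosh.
exact: exprn_continuous.
Qed.

Lemma integrable_tv_density : mu.-integrable setT (EFin \o tv_density).
Proof.
apply: (dominated_integrable measurable_tv_density); last first.
  apply: integrable_scale (phi_peak * (M / k%:R) ^+ k) _ _.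
  by apply: (@integrable_moment _ k (1 / 2) M); lra.
by move=> x; rewrite ger0_norm ?tv_density_ge0// tv_density_le.
Qed.

Lemma chi_density_le x : 0 <= chi_density x <= tv_density x.
Proof.
have C0 := cosh_gt0 (x * (M / k%:R)).
have h := normr_sinh_le_cosh (x * (M / k%:R)).
have p := ltW (phi_gt0 x).
rewrite /chi_density /tv_density mulr_ge0 ?divr_ge0 ?sqr_ge0 ?exprn_ge0 ?(ltW C0)//=.
rewrite ler_wpM2l// ler_pdivrMr ?exprn_gt0//.
by rewrite -[leLHS]real_normK ?num_real// expr2 normrX ler_wpM2l ?exprn_ge0// lerXn2r// nnegrE ltW.
Qed.

Lemma integrable_chi_density : mu.-integrable setT (EFin \o chi_density).
Proof.
apply: (dominated_integrable measurable_chi_density) integrable_tv_density => x.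
by have /andP[h0 h1] := chi_density_le x; rewrite ger0_norm.
Qed.

Let p := gauss_mixture (even_mixture M k).
Let q := gauss_mixture (odd_mixture M k).

Let kappa_gt0 : 0 < kappa M k.
Proof.
have /andP[+ _] := kappa_bounds (ltW M0) ok.
by apply: lt_le_trans; exact: expR_gt0.
Qed.

Lemma TV_mixtureE : TV p q = kappa M k * Rintegral mu setT tv_density.
Proof.
have e : (fun x => `|p x - q x|) = (fun x => 2 * kappa M k * tv_density x).
  apply/funext => x; rewrite /p /q even_mixtureE ?(ltW M0)// odd_mixtureE ?(ltW M0)//.
  rewrite -mulrBr.
  have -> (c s : R) : c - s - (c + s) = - (2 * s) by ring.
  rewrite mulrN normrN normrM (gtr0_norm (mulr_gt0 kappa_gt0 (phi_gt0 x))).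
  by rewrite normrM normrX (@ger0_norm _ 2)// /tv_density; ring.
rewrite /TV e RintegralZl//; last exact: integrable_tv_density.
by field.
Qed.

Lemma hellinger_mixture_ge :
  kappa M k / 2 * Rintegral mu setT chi_density <= hellinger p q ^+ 2.
Proof.
pose D x := (Num.sqrt (p x) - Num.sqrt (q x)) ^+ 2.
have DE x : D x = (Num.sqrt (kappa M k * phi x *
    (cosh (x * (M / k%:R)) ^+ k - sinh (x * (M / k%:R)) ^+ k)) -
  Num.sqrt (kappa M k * phi x *
    (cosh (x * (M / k%:R)) ^+ k + sinh (x * (M / k%:R)) ^+ k))) ^+ 2.
  by rewrite /D /p /q even_mixtureE ?(ltW M0)// odd_mixtureE ?(ltW M0).
have bounds x : kappa M k * chi_density x <= D x <= 2 * kappa M k * tv_density x.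
  have w0 := ltW (mulr_gt0 kappa_gt0 (phi_gt0 x)).
  have SC : `|sinh (x * (M / k%:R)) ^+ k| <= cosh (x * (M / k%:R)) ^+ k.
    by rewrite normrX lerXn2r ?nnegrE ?normr_sinh_le_cosh// ltW// cosh_gt0.
  have /andP[h1 h2] := sqr_sub_sqrt_bounds w0 SC.
  rewrite DE /chi_density /tv_density; apply/andP; split.
    by rewrite mulrA.
  by rewrite -normrX; apply: (le_trans h2); rewrite !mulrA.
have D0 x : 0 <= D x by exact: sqr_ge0.
have msqrt : measurable_fun setT (@Num.sqrt R).
  by apply: continuous_measurable_fun; exact: sqrt_continuous.
have mD : measurable_fun setT D.
  rewrite (funext DE); apply: measurable_funX; apply: measurable_funB;
    (apply: measurableT_comp => //; apply: measurable_funM;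
      [by apply: measurable_funM => //; exact: measurable_phi|]);
    [apply: measurable_funB|apply: measurable_funD]; apply: measurable_funX;
    apply: measurable_scaled; first [exact: continuous_cosh|exact: continuous_sinh].
(* Integrability, from the upper bound on [D], is required for comparing integrals: [Rintegral]
   could otherwise be a default value. *)
have iD : mu.-integrable setT (EFin \o D).
  apply: (dominated_integrable mD) (integrable_scale (2 * kappa M k) integrable_tv_density).
  by move=> x; rewrite ger0_norm//; have /andP[] := bounds x.
rewrite /hellinger sqr_sqrtr; last first.
  by apply: mulr_ge0 => //; apply: Rintegral_ge0 => x _; exact: D0.
rewrite mulrAC [leLHS]mulrC ler_wpM2l// -RintegralZl//; last exact: integrable_chi_density.
apply: le_Rintegral => //; first exact: integrable_scale integrable_chi_density.
by move=> x _; have /andP[] := bounds x.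
Qed.

Lemma TV_mixture_le_expRN : TV p q <= expR (- k%:R) *
  (phi_peak * Rintegral mu setT (fun x => expR (- (1 / 2 * x ^+ 2) + 2 * M * `|x|))).
Proof.
have hi := integrable_gauss_abs (2 * M) (divr_gt0 ltr01 (ltr0Sn R 1)).
have /andP[_ kap] := kappa_bounds (ltW M0) ok.
rewrite TV_mixtureE; apply: (@le_trans _ _ (Rintegral mu setT tv_density)).
  by rewrite ler_piMl// Rintegral_ge0// => x _; exact: tv_density_ge0.
rewrite mulrA -RintegralZl//; apply: le_Rintegral => //.
- exact: integrable_tv_density.
- exact: integrable_scale.
- by move=> x _; rewrite -mulrA; exact: tv_density_le_expRN.
Qed.

(** Only the unit interval [[a, a + 1]] is kept, with the power bounded below at its left end and
    the exponential at its right end. *)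
Lemma TV_mixture_ge a : 0 <= a ->
  kappa M k * (phi_peak * (M / k%:R) ^+ k *
    (a ^+ k * expR (- (1 / 2 * (a + 1) ^+ 2) - M * (a + 1)))) <= TV p q.
Proof.
move=> a0; rewrite TV_mixtureE ler_pM2l//.
set c := _ * expR _; set r := phi_peak * _.
have r0 : 0 <= r.
  by rewrite /r mulr_ge0 ?exprn_ge0 ?divr_ge0 ?(ltW M0)// ltW// phi_peak_gt0.
have c0 : 0 <= c by rewrite mulr_ge0 ?exprn_ge0 ?expR_ge0.
have mA : measurable (`[a, a + 1] : set (measurableTypeR R)) by exact: measurable_itv.
have lA : mu `[a, a + 1] = 1%E.
  by rewrite /mu lebesgue_measure_itv/= lte_fin ltrDl ltr01 -EFinB addrAC subrr add0r.
have iA : mu.-integrable setT (EFin \o \1_`[a, a + 1]) by exact: integrable_indic_itv.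
have -> : r * c = Rintegral mu setT (fun x => r * c * \1_(`[a, a + 1]) x).
  rewrite RintegralZl//.
  by rewrite /Rintegral integral_indic// setIT [X in fine X]lA mulr1.
apply: le_Rintegral => //.
- exact: integrable_scale.
- exact: integrable_tv_density.
move=> x _; rewrite indicE; case: (boolP (_ \in _)); last first.
  by move=> _; rewrite mulr0 tv_density_ge0.
rewrite inE/= in_itv/= => /andP[ax xa]; rewrite mulr1.
apply: le_trans (tv_density_ge x); rewrite -/r ler_wpM2l//.
have x0 : 0 <= x by exact: le_trans ax.
rewrite (ger0_norm x0); apply: ler_pM; rewrite ?exprn_ge0 ?expR_ge0//.
  by rewrite lerXn2r// nnegrE.
rewrite ler_expR mulNr.
have h1 : x ^+ 2 <= (a + 1) ^+ 2 by rewrite lerXn2r// nnegrE// addr_ge0.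
have h2 : M * x <= M * (a + 1) by rewrite ler_pM2l.
lra.
Qed.

(** This integral appears in the upper bound for [TV ^ 2] and in the lower bound for [H ^ 2]; it
    cancels in the ratio and is never evaluated. *)
Let moment := Rintegral mu setT (fun x => `|x| ^+ (2 * k) * expR (- (15 / 16 * x ^+ 2))).

Lemma TV_mixture_sqr_le : TV p q ^+ 2 <= phi_peak ^+ 2 * ((M / k%:R) ^+ k) ^+ 2 *
  (moment * Rintegral mu setT (fun x => expR (- (1 / 16 * x ^+ 2) + 2 * M * `|x|))).
Proof.
(* The exponent 1/2 is split as 15/32 + 1/32: [f] takes the power and most of the Gaussian, while
   [g] keeps just enough to make the linear exponent integrable, with a norm independent of [k]. *)
pose f x := `|x| ^+ k * expR (- (15 / 32 * x ^+ 2)).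
pose g x := expR (- (1 / 32 * x ^+ 2) + M * `|x|).
have f2 : (fun x => f x ^+ 2) = (fun x => `|x| ^+ (2 * k) * expR (- (15 / 16 * x ^+ 2))).
  apply/funext => x; rewrite /f exprMn -exprM mulnC -expRM_natl.
  by congr (_ * expR _); field.
have g2 : (fun x => g x ^+ 2) = (fun x => expR (- (1 / 16 * x ^+ 2) + 2 * M * `|x|)).
  by apply/funext => x; rewrite /g -expRM_natl; congr expR; field.
have fg : (fun x => f x * g x) =
    (fun x => `|x| ^+ k * expR (- (1 / 2 * x ^+ 2) + M * `|x|)).
  by apply/funext => x; rewrite /f /g -mulrA -expRD; congr (_ * expR _); field.
have i2 : mu.-integrable setT (EFin \o (fun x => f x ^+ 2)).
  rewrite f2; have := @integrable_moment R (2 * k) (15 / 16) 0.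
  by under eq_fun do rewrite mul0r addr0; apply; lra.
have j2 : mu.-integrable setT (EFin \o (fun x => g x ^+ 2)).
  by rewrite g2; apply: integrable_gauss_abs; lra.
have ij : mu.-integrable setT (EFin \o (fun x => f x * g x)).
  by rewrite fg; apply: integrable_moment; lra.
have CS := Rintegral_cauchy_schwarz i2 j2 ij.
have /andP[_ kap] := kappa_bounds (ltW M0) ok.
have r0 : 0 <= phi_peak * (M / k%:R) ^+ k.
  by rewrite mulr_ge0 ?exprn_ge0 ?divr_ge0 ?(ltW M0)// ltW// phi_peak_gt0.
have TV0 : 0 <= TV p q.
  by rewrite TV_mixtureE mulr_ge0 ?(ltW kappa_gt0)// Rintegral_ge0// => x _; exact: tv_density_ge0.
have TV1 : TV p q <= phi_peak * (M / k%:R) ^+ k * Rintegral mu setT (fun x => f x * g x).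
  rewrite TV_mixtureE; apply: (@le_trans _ _ (Rintegral mu setT tv_density)).
    by rewrite ler_piMl// Rintegral_ge0// => x _; exact: tv_density_ge0.
  rewrite -RintegralZl//; apply: le_Rintegral => //.
  - exact: integrable_tv_density.
  - exact: integrable_scale.
  - by move=> x _; rewrite -[f x * g x]/((fun x => f x * g x) x) fg; exact: tv_density_le.
rewrite /moment -f2 -g2 -exprMn; apply: le_trans (_ : _ <=
  (phi_peak * (M / k%:R) ^+ k) ^+ 2 * Rintegral mu setT (fun x => f x * g x) ^+ 2) _.
  by rewrite -exprMn lerXn2r// nnegrE// (le_trans TV0).
by rewrite ler_wpM2l// sqr_ge0.
Qed.

Lemma hellinger_mixture_sqr_ge : expR (- (M ^+ 2 / 2)) / 2 * phi_peak *
  ((M / k%:R) ^+ k) ^+ 2 * expR (- (45 / 2 * M ^+ 2)) * (5 / 4) ^+ (2 * k) * moment <=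
  hellinger p q ^+ 2.
Proof.
have /andP[kap _] := kappa_bounds (ltW M0) ok.
have J0 : 0 <= moment.
  by apply: Rintegral_ge0 => x _; rewrite mulr_ge0 ?exprn_ge0 ?expR_ge0.
have r0 : 0 <= phi_peak * ((M / k%:R) ^+ k) ^+ 2.
  by rewrite mulr_ge0 ?sqr_ge0// ltW// phi_peak_gt0.
apply: le_trans hellinger_mixture_ge.
pose m x := `|x| ^+ (2 * k) * expR (- (3 / 5 * x ^+ 2)).
have im : mu.-integrable setT (EFin \o m).
  rewrite /m; have := @integrable_moment R (2 * k) (3 / 5) 0.
  by under eq_fun do rewrite mul0r addr0; apply; lra.
have chi_ge x : phi_peak * ((M / k%:R) ^+ k) ^+ 2 * expR (- (45 / 2 * M ^+ 2)) * m x <=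
    chi_density x.
  apply: le_trans (chi_density_ge x); rewrite -[leLHS]mulrA ler_wpM2l//.
  rewrite /m mulrCA ler_wpM2l ?exprn_ge0// -expRD ler_expR.
  rewrite -[x ^+ 2]real_normK ?num_real//.
  (* One tenth of this square gives [3 M |x| <= x ^ 2 / 10 + 45 / 2 M ^ 2], and 1/2 + 1/10 = 3/5 is
     the exponent in [m]. *)
  have := sqr_ge0 (`|x| - 15 * M); rewrite sqrrB; lra.
have h : phi_peak * ((M / k%:R) ^+ k) ^+ 2 * expR (- (45 / 2 * M ^+ 2)) *
    (5 / 4) ^+ (2 * k) * moment <= Rintegral mu setT chi_density.
  apply: (@le_trans _ _ (phi_peak * ((M / k%:R) ^+ k) ^+ 2 *
      expR (- (45 / 2 * M ^+ 2)) * Rintegral mu setT m)).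
    rewrite -[leLHS]mulrA; apply: ler_wpM2l; first exact: mulr_ge0 r0 (expR_ge0 _).
    rewrite [Rintegral mu setT m]moment_scale -/moment ler_wpM2r//.
    (* The scaling produces the power [2 k + 1] of 5/4; the extra factor is at least 1 and is
       dropped. *)
    by rewrite exprS ler_peMl ?exprn_ge0//; lra.
  rewrite -RintegralZl//; apply: le_Rintegral => //.
  - exact: integrable_scale.
  - exact: integrable_chi_density.
  - by move=> x _; exact: chi_ge.
have J1 : 0 <= Rintegral mu setT chi_density.
  by apply: Rintegral_ge0 => x _; have /andP[] := chi_density_le x.
apply: (@le_trans _ _ (expR (- (M ^+ 2 / 2)) / 2 * Rintegral mu setT chi_density)).
  by rewrite -!mulrA in h *; rewrite !ler_wpM2l ?expR_ge0.
by rewrite ler_wpM2r// ler_pM2r.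
Qed.

End distances.

(** * Asymptotics of the exponent *)

Section asymptotics.
Context {R : realType}.
Implicit Types (t a b : R) (k : nat).

(** From [ln (b / a) <= b / a - 1] one gets [a (ln b - ln a) <= b - a], which is at most
    [(b - a) ln a] since [ln a >= 1]. *)
Lemma ler_div_ln a b : expR 1 <= a -> a <= b -> a / ln a <= b / ln b.
Proof.
move=> ea ab; have e0 : 0 < expR 1 :> R by exact: expR_gt0.
have a0 : 0 < a by exact: lt_le_trans ea.
have b0 : 0 < b by exact: lt_le_trans ab.
have la : 1 <= ln a by rewrite -(expRK 1) ler_ln ?posrE.
have lb : ln a <= ln b by rewrite ler_ln ?posrE.
have lab : ln b - ln a <= b / a - 1.
  rewrite -ln_div ?posrE//.
  by have := ln_sublinear (divr_gt0 b0 a0); have := expR_ge1Dx (ln (b / a));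
    rewrite lnK ?posrE ?divr_gt0//; lra.
have : a * (ln b - ln a) <= b - a.
  apply: (@le_trans _ _ (a * (b / a - 1))); first by rewrite ler_pM2l.
  by rewrite mulrBr mulr1 mulrCA divff ?gt_eqF// mulr1.
rewrite mulrBr => h.
rewrite ler_pdivrMr; last lra.
rewrite mulrAC ler_pdivlMr; last lra.
nra.
Qed.

Lemma powR_alpha_star t : 0 < t -> t < 1 ->
  t `^ (1 - alpha_star t) = t * expR (33 / 100 * (- ln t / ln (- ln t))).
Proof.
move=> t0 t1; rewrite /powR gt_eqF// -[in RHS](@lnK _ t) ?posrE//.
rewrite -expRD /alpha_star ln_div ?posrE// ln1 sub0r lnK ?posrE//.
congr expR; ring.
Qed.

(** The tangent bound [exp y >= 1 + y] at [y = - ln (5 / 4)]. *)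
Lemma ln_5_4 : 1 / 5 <= ln (5 / 4) :> R.
Proof.
have h := expR_ge1Dx (- ln (5 / 4) : R).
have e : expR (- ln (5 / 4)) = 4 / 5 :> R by rewrite expRN lnK ?posrE//; field.
lra.
Qed.

(** With [L = - ln t], the lower bound on [t] controls [L / ln L] from above, and the upper bound
    brings [L] into the range where this quotient is increasing. *)
Lemma powR_alpha_star_le (A B C : R) : 0 < B -> 0 < C ->
  \forall k \near \oo, forall t,
    expR (- (k%:R / 2 * ln k%:R + A * k%:R)) <= t -> t <= B * expR (- k%:R) ->
    t < expR (- expR 1) /\ t `^ (1 - alpha_star t) <= C * (5 / 4) ^+ k * t.
Proof.
move=> B0 C0; near=> k => t tlo thi.
have t0 : 0 < t by apply: lt_le_trans tlo; exact: expR_gt0.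
(* The thresholds give in turn: [ln k >= 2], so that [k <= U] below; [|A| k <= k ln k / 33];
   [- ln C <= k / 50]; and [- ln t >= e + 1]. *)
have k1 : expR 2 <= k%:R :> R by near: k; exact: nbhs_infty_ger.
have k2 : expR (33 * `|A|) <= k%:R :> R by near: k; exact: nbhs_infty_ger.
have k3 : 50 * - ln C <= k%:R :> R by near: k; exact: nbhs_infty_ger.
have k4 : ln B + expR 1 + 1 <= k%:R :> R by near: k; exact: nbhs_infty_ger.
have k0 : 0 < k%:R :> R by apply: lt_le_trans k1; exact: expR_gt0.
have lk1 : 2 <= ln k%:R :> R by rewrite -(expRK 2) ler_ln ?posrE ?expR_gt0.
have lk2 : 33 * `|A| <= ln k%:R :> R.
  by rewrite -(expRK (33 * _)) ler_ln ?posrE ?expR_gt0.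
have A1 : A <= `|A| by exact: ler_norm.
pose U := k%:R / 2 * ln k%:R + `|A| * k%:R.
have Llo : k%:R - ln B <= - ln t.
  rewrite lerNr opprB -(expRK (_ - _)) ler_ln ?posrE ?expR_gt0//.
  by rewrite expRD lnK ?posrE.
have Lhi : - ln t <= U.
  rewrite lerNl -(expRK (- U)) ler_ln ?posrE ?expR_gt0//; apply: le_trans tlo.
  by rewrite ler_expR lerN2 lerD2l ler_wpM2r// ltW.
have Le : expR 1 + 1 <= - ln t by lra.
have t1 : t < expR (- expR 1).
  by rewrite -ltr_ln ?posrE ?expR_gt0// expRK; lra.
split => //.
have e0 := expR_gt0 (1 : R).
have t2 : t < 1 by apply: lt_trans t1 _; rewrite -[ltRHS]expR0 ltr_expR; lra.
rewrite powR_alpha_star// [leRHS]mulrC ler_pM2l//.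
have kU : k%:R <= U.
  rewrite /U; have : 0 <= `|A| * k%:R by rewrite mulr_ge0// ltW.
  have : k%:R * 2 <= k%:R * ln k%:R :> R by rewrite ler_pM2l.
  lra.
have U0 : 0 < U by exact: lt_le_trans kU.
have lU : ln k%:R <= ln U by rewrite ler_ln ?posrE.
have main : - ln t / ln (- ln t) <= 1 / 2 * k%:R + 1 / 33 * k%:R.
  apply: (@le_trans _ _ (U / ln U)); first by apply: ler_div_ln => //; lra.
  apply: (@le_trans _ _ (U / ln k%:R)).
    by rewrite ler_pM2l// lef_pV2 ?posrE; lra.
  rewrite ler_pdivrMr; last lra.
  rewrite /U.
  have : 33 * `|A| * k%:R <= ln k%:R * k%:R by rewrite ler_pM2r.
  lra.
have -> : C * (5 / 4) ^+ k = expR (ln C + k%:R * ln (5 / 4)).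
  by rewrite expRD lnK ?posrE// expRM_natl lnK ?posrE.
rewrite ler_expR.
(* The margin: 0.33 (1/2 + 1/33) = 0.175, so 1/5 leaves [k / 40], which covers
   [- ln C <= k / 50]. *)
have h : k%:R * (1 / 5) <= k%:R * ln (5 / 4) :> R by rewrite ler_pM2l// ln_5_4.
lra.
Unshelve. all: by end_near. Qed.

End asymptotics.

(** * Bounds uniform in [k], and choice of the sequences *)

Section conclusion.
Context {R : realType}.
Variable M : R.
Hypothesis M0 : 0 < M.
Let mu := @lebesgue_measure R.

Let TV_ k := TV (gauss_mixture (even_mixture M k)) (gauss_mixture (odd_mixture M k)).
Let H_ k := hellinger (gauss_mixture (even_mixture M k)) (gauss_mixture (odd_mixture M k)).

Lemma TV_mixture_lower : exists A : R, forall k, odd k ->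
  expR (- (k%:R / 2 * ln k%:R + A * k%:R)) <= TV_ k.
Proof.
pose c : R := phi_peak.
(* The terms pay, in order, for [kappa], the peak of [phi], the factor [M ^ k],
   [(a + 1) ^ 2 / 2 <= 2 k] and [M (a + 1) <= 2 M k]. *)
exists (M ^+ 2 / 2 + `|ln c| + `|ln M| + 2 + 2 * M) => k ok.
have k1 : 1 <= k%:R :> R by rewrite ler1n; case: k ok.
have k0 : 0 < k%:R :> R by lra.
have lk : 0 <= ln k%:R :> R by exact: ln_ge0.
(* This is the square root of [k], where [x ^ k * exp (- x ^ 2 / 2)] peaks; then
   [(M / k) ^ k * a ^ k] supplies the main term [- k / 2 * ln k] of the exponent. *)
pose a : R := expR (ln k%:R / 2).
have a2 : a ^+ 2 = k%:R by rewrite /a -expRM_natl mulrCA divff// mulr1 lnK.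
have a1 : 1 <= a by rewrite -expR0 ler_expR divr_ge0.
have ak : a <= k%:R by rewrite -a2 expr2 ler_peMr// (le_trans ler01).
apply: le_trans (TV_mixture_ge M0 ok (le_trans ler01 a1)).
have /andP[kap _] := kappa_bounds (ltW M0) ok.
set Y := (X in _ <= _ * X); have Y0 : 0 <= Y.
  apply: mulr_ge0; first apply: mulr_ge0; first exact/ltW/phi_peak_gt0.
    by rewrite exprn_ge0// divr_ge0// ltW.
  by apply: mulr_ge0; rewrite ?expR_ge0// exprn_ge0// (le_trans ler01 a1).
apply: le_trans (ler_wpM2r Y0 kap).
have -> : Y = expR (ln c) * (expR (k%:R * (ln M - ln k%:R)) *
    (expR (k%:R * (ln k%:R / 2)) * expR (- (1 / 2 * (a + 1) ^+ 2) - M * (a + 1)))).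
  rewrite /Y lnK ?posrE ?phi_peak_gt0// -/c mulrA; congr (_ * _ * (_ * _)).
    by rewrite expRM_natl -ln_div ?posrE// lnK// posrE divr_gt0.
  by rewrite expRM_natl.
rewrite -!expRD ler_expR sqrrD a2 mulr1 expr1n.
have h1 : - `|ln c| <= ln c by have := ler_norm (- ln c); rewrite normrN; lra.
have h2 : - `|ln M| * k%:R <= ln M * k%:R.
  by rewrite ler_pM2r//; have := ler_norm (- ln M); rewrite normrN; lra.
have h3 : `|ln c| * 1 <= `|ln c| * k%:R by rewrite ler_wpM2l.
have h4 : M ^+ 2 * 1 <= M ^+ 2 * k%:R by rewrite ler_wpM2l// sqr_ge0.
have h5 : M * (a + 1) <= M * (2 * k%:R) by rewrite ler_pM2l//; lra.
lra.
Qed.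

Lemma TV_mixture_upper : exists2 B : R, 0 < B & forall k, odd k ->
  TV_ k <= B * expR (- k%:R).
Proof.
pose B := phi_peak * Rintegral mu setT
  (fun x => expR (- (1 / 2 * x ^+ 2) + 2 * M * `|x|)).
have B0 : 0 <= B.
  rewrite mulr_ge0 ?(ltW phi_peak_gt0)// Rintegral_ge0// => x _; exact: expR_ge0.
(* Adding 1 gives a positive constant from [B >= 0] alone; [K + 1] in [hellinger_mixture_TV]
   likewise avoids a zero denominator. *)
exists (B + 1) => [|k ok]; first lra.
apply: (le_trans (TV_mixture_le_expRN M0 ok)).
by rewrite -/B mulrC ler_wpM2r ?expR_ge0// lerDl.
Qed.

(** Comparing the two bounds on squares, the moment and [(M / k) ^ (2 k)] cancel and
    [D * (5 / 4) ^ (2 k)] is left; the square root gives the claim. *)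
Lemma hellinger_mixture_TV : exists2 C : R, 0 < C & forall k, odd k ->
  C * (5 / 4) ^+ k * TV_ k <= H_ k.
Proof.
pose c : R := phi_peak; have c0 : 0 < c by exact: phi_peak_gt0.
pose K := Rintegral mu setT (fun x => expR (- (1 / 16 * x ^+ 2) + 2 * M * `|x|)).
have K0 : 0 <= K by apply: Rintegral_ge0 => x _; exact: expR_ge0.
pose X := expR (- (M ^+ 2 / 2)) / 2 * c * expR (- (45 / 2 * M ^+ 2)).
have X0 : 0 < X by rewrite !mulr_gt0 ?expR_gt0.
pose D := X / (c ^+ 2 * (K + 1)).
have D0 : 0 < D by rewrite divr_gt0// mulr_gt0 ?exprn_gt0//; lra.
exists (Num.sqrt D) => [|k ok]; first by rewrite sqrtr_gt0.
have := TV_mixture_sqr_le M0 ok; have := hellinger_mixture_sqr_ge M0 ok.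
rewrite -/(TV_ k) -/(H_ k) -/K -/c.
set J := Rintegral _ _ _; set r := ((M / k%:R) ^+ k) ^+ 2 => hH hT.
have J0 : 0 <= J.
  by apply: Rintegral_ge0 => x _; rewrite mulr_ge0 ?exprn_ge0 ?expR_ge0.
have r0 : 0 <= r by exact: sqr_ge0.
have H0 : 0 <= H_ k by exact: sqrtr_ge0.
apply: le_trans (ler_norm _) _; rewrite -[leRHS]ger0_norm// -ler_sqr ?nnegrE//.
rewrite !real_normK ?num_real//; apply: le_trans hH.
rewrite exprMn [X in X * _]exprMn sqr_sqrtr ?(ltW D0)// -exprM [(k * 2)%N]mulnC.
have q0 : 0 <= D * (5 / 4) ^+ (2 * k) by rewrite mulr_ge0 ?exprn_ge0 ?(ltW D0).
apply: (le_trans (ler_wpM2l q0 hT)).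
apply: (@le_trans _ _ (D * (5 / 4) ^+ (2 * k) * (c ^+ 2 * r * (J * (K + 1))))).
  apply: ler_wpM2l => //; apply: ler_wpM2l; first by rewrite mulr_ge0 ?sqr_ge0.
  by apply: ler_wpM2l => //; rewrite lerDl.
rewrite le_eqVlt; apply/orP; left; apply/eqP; rewrite /D /X -/c.
by field; rewrite !gt_eqF//; lra.
Qed.

End conclusion.

(** After each index a positive null sequence has a strictly smaller term; iterating such a choice
    from [n0] gives [s]. This provides monotone total variations without comparing consecutive
    values of [k]. *)
Lemma exists_decreasing_subsequence {R : realType} (u : nat -> R) (n0 : nat) :
  (forall n, 0 < u n) -> u n @[n --> \oo] --> (0 : R) ->
  exists2 s : nat -> nat, (forall n, (n0 + n <= s n)%N) &
    decreasing_seq (u \o s).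
Proof.
move=> u0 ucvg.
have /choice[f fP] : forall n, exists m, (n < m)%N /\ u m < u n.
  move=> n; have /cvgr_lt/(_ _ (u0 n)) un := ucvg.
  have [m [mn um]] : exists m, (n < m)%N /\ u m < u n.
    by have /filter_ex[m [? ?]] : \forall m \near \oo, (n < m)%N /\ u m < u n;
      [apply: filterI => //; exact: nbhs_infty_gt|exists m].
  by exists m.
exists (fun n => iter n f n0) => [n|].
  elim: n => [|n IH]; first by rewrite addn0.
  by rewrite addnS iterS (leq_ltn_trans IH)//; have [] := fP (iter n f n0).
by apply/decreasing_seqP => n; rewrite /= ; have [] := fP (iter n f n0).
Qed.

Theorem theorem3p1 (R : realType) (M : R) (M_gt0 : 0 < M) :
  exists pi_ eta_ : nat -> probability (measurableTypeR R) R,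
    [/\ forall n, supported_on (pi_ n) `[- M, M],
        forall n, supported_on (eta_ n) `[- M, M] &
        let TV_ n := TV (gauss_mixture (pi_ n)) (gauss_mixture (eta_ n)) in
        let H_ n := hellinger (gauss_mixture (pi_ n)) (gauss_mixture (eta_ n)) in
        [/\ decreasing_seq TV_,
            TV_ n @[n --> \oo] --> (0 : R),
            forall n, TV_ n < expR (- expR 1) &
            forall n, H_ n >= TV_ n `^ (1 - alpha_star (TV_ n))]].
Proof.
have [A lower] := TV_mixture_lower M_gt0.
have [B B0 upper] := TV_mixture_upper M_gt0.
have [C C0 hell] := hellinger_mixture_TV M_gt0.
have [N _ HN] := powR_alpha_star_le A B0 C0.
pose T n := TV (gauss_mixture (even_mixture M n.*2.+1))
               (gauss_mixture (odd_mixture M n.*2.+1)).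
have ok n : odd n.*2.+1 by rewrite /= odd_double.
have T0 n : 0 < T n by apply: lt_le_trans (lower _ (ok n)); exact: expR_gt0.
have le2 n : (n <= n.*2.+1)%N by rewrite -addnn -addnS leq_addr.
have Tcvg : T n @[n --> \oo] --> (0 : R).
  apply: (@squeeze_cvgr _ _ _ _ (fun=> 0) (fun n => B * expR (- n%:R))).
  - near=> n; rewrite (ltW (T0 n))/=; apply: (le_trans (upper _ (ok n))).
    by rewrite ler_pM2l// ler_expR lerN2 ler_nat.
  - exact: cvg_cst.
  - by rewrite -[X in _ --> X](mulr0 B); apply: cvgMr; exact: cvgn_expR.
(* Starting at [N] makes the eventual estimates of [HN] hold for every term of the subsequence. *)
have [s sN sdec] := exists_decreasing_subsequence N T0 Tcvg.
have Nk n : (N <= (s n).*2.+1)%N.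
  by apply: leq_trans (le2 _); apply: leq_trans (sN n); exact: leq_addr.
exists (fun n => even_mixture M (s n).*2.+1), (fun n => odd_mixture M (s n).*2.+1).
split => [n|n|]; first exact: even_mixture_supported (ltW M_gt0) (ok _).
  exact: odd_mixture_supported (ltW M_gt0) (ok _).
move=> TV_ H_; split => [||n|n]; first exact: sdec.
- apply: (@cvg_comp _ _ _ s T) Tcvg.
  apply/cvgnyPge => m; near=> n; apply: leq_trans (sN n).
  by apply: leq_trans (leq_addl _ _); near: n; exact: nbhs_infty_ge.
- by have [] := HN _ (Nk n) _ (lower _ (ok _)) (upper _ (ok _)).
- have [_ h] := HN _ (Nk n) _ (lower _ (ok _)) (upper _ (ok _)).
  exact: le_trans h (hell _ (ok _)).
Unshelve. all: by end_near. Qed.
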